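(* Fix $\alpha>1$, $\delta\in(0,1)$, $n_d\in\mathbb{N}$. Let $(P,P')$, with $P$ a distribution on $\{0,\dots,n_d-1\}$ and $P'$ a distribution on $\{1,\dots,n_d-1\}$, be an optimal solution of the convex program $$\text{minimize } \sum_{x} P'(x)^\alpha P'(n_d-x)^{1-\alpha}$$ subject to $P(x)\ge0$, $\sum_x P(x)=\sum_x P'(x)=1$, $0\le P'(x)\le\frac{P(x)}{1-\delta}$, and $P(x)=P(n_d-1-x)$ for all $x$. Then $P$ minimizes $\varepsilon(X) := \max\{D^\delta_\alpha(X\|X_+),\,D^\delta_\alpha(X_+\|X)\}$ over all probability distributions $X$ supported on $\{0,\dots,n_d-1\}$. Equivalently, $P$ (up to translation) gives the best $(\delta,\alpha,\varepsilon)$-RDP guarantee among all additive-noise partition selection mechanisms whose primitive $\pi$ satisfies $\pi(n_d)=1$.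
   Context: Conventions: $0^\alpha 0^{1-\alpha}=0$, $u^\alpha0^{1-\alpha}=\infty$ for $u>0$. For a distribution $X$ on $\mathbb{Z}$, $X_+$ is its shift by one: $X_+(x)=X(x-1)$. For $\alpha>1$, $D_\alpha(P\|Q)=\frac{1}{\alpha-1}\log\sum_x P(x)^\alpha Q(x)^{1-\alpha}$, and $D^\delta_\alpha(P\|Q)=\inf\{D_\alpha(P'\|Q'): P=(1-\delta)P'+\delta P'',\ Q=(1-\delta)Q'+\delta Q''\}$ over probability distributions. An additive-noise partition selection mechanism is given by a distribution $X$ with finite support in $(-\infty,\tau]\cap\mathbb{Z}$; on count $n$ it samples $Z\sim X$, releases $n+Z$, and keeps the partition iff $n+Z>\tau$, so its primitive is $\pi_X(n)=\Pr_{Z\sim X}(n+Z>\tau)$; for count-neighbors differing by one, it is $(\delta,\alpha,\varepsilon)$-RDP exactly when $\varepsilon\ge\max\{D^\delta_\alpha(X\|X_+),D^\delta_\alpha(X_+\|X)\}$. The condition $\pi_X(n_d)=1$ means the support of $X$ lies in $n_d$ consecutive integers, which up to translation is $\{0,\dots,n_d-1\}$. *)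

(* Defs.v *)
From HB Require Import structures.
From mathcomp Require Import all_boot all_order all_algebra.
From mathcomp Require Import all_classical all_reals all_analysis.
Import Order.TTheory GRing.Theory Num.Theory.
Local Open Scope classical_set_scope.
Local Open Scope ring_scope.

Section Defs.
Context {R : realType}.

Definition sumZ (f : int -> R) : R := \sum_(x \in [set: int]) f x.

Definition is_prob (p : int -> R) : Prop :=
  [/\ (forall x, 0 <= p x), finite_set [set x | p x != 0] & sumZ p = 1].

Definition supported_on (p : int -> R) (a b : int) : Prop :=
  forall x, p x != 0 -> a <= x <= b.

Definition shiftZ (p : int -> R) : int -> R := fun x => p (x - 1).

(* sum_x p(x)^a q(x)^(1-a), with 0^a 0^(1-a) = 0 and u^a 0^(1-a) = +oo (u>0) *)
Definition renyi_sum (a : R) (p q : int -> R) : \bar R :=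
  if `[< exists x, p x != 0 /\ q x = 0 >] then +oo%E
  else (sumZ (fun x => if p x == 0 then 0 else p x `^ a * q x `^ (1 - a)))%:E.

Definition renyi_div (a : R) (p q : int -> R) : \bar R :=
  if renyi_sum a p q == +oo%E then +oo%E
  else ((a - 1)^-1 * ln (fine (renyi_sum a p q)))%:E.

Definition approx_renyi_div (a d : R) (p q : int -> R) : \bar R :=
  ereal_inf [set v | exists p1 p2 q1 q2 : int -> R,
    [/\ is_prob p1, is_prob p2, is_prob q1, is_prob q2 &
        [/\ (forall x, p x = (1 - d) * p1 x + d * p2 x),
             (forall x, q x = (1 - d) * q1 x + d * q2 x) &
             v = renyi_div a p1 q1]]].

Definition rdp_eps (a d : R) (X : int -> R) : \bar R :=
  maxe (approx_renyi_div a d X (shiftZ X)) (approx_renyi_div a d (shiftZ X) X).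

Definition cp_feasible (d : R) (nd : nat) (P P' : int -> R) : Prop :=
  [/\ is_prob P, supported_on P 0 (nd%:Z - 1),
      is_prob P', supported_on P' 1 (nd%:Z - 1) &
      (forall x, 0 <= P' x <= P x / (1 - d))] /\
      (forall x, P x = P (nd%:Z - 1 - x)).

Definition cp_obj (a : R) (nd : nat) (P' : int -> R) : \bar R :=
  renyi_sum a P' (fun x => P' (nd%:Z - x)).

End Defs.

(* Main.v *)
Require Import Defs.
From HB Require Import structures.
From mathcomp Require Import all_boot all_order all_algebra.
From mathcomp Require Import all_classical all_reals all_analysis.
From mathcomp Require Import ring lra zify.
Import Order.TTheory GRing.Theory Num.Theory.
Import numFieldNormedType.Exports.
Local Open Scope ring_scope.

(* Two decompositions, of (X, X_+) and of (X_+, X), are averaged after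
   reflecting the second one by x |-> n - x; their average is dominated by the
   caps U = P / (1 - d) and V = U_+, where P is the symmetrization of X. Among
   all pairs dominated by (U, V), the clipped pair
   (c min(U, t V), c min(V, t U)) is optimal, for every a at once; since
   V x = U (n - x), its second component is the reflection of the first, which
   is exactly the form of the pairs in the convex program. *)

(** * Pointwise Renyi terms and their supporting lines *)

(** For [q = 0 < p] and [1 < a] the real power of zero makes this term [0] instead of [+oo], hence
    the hypotheses [q = 0 -> p = 0] below. *)
Definition renyi_term {R : realType} (a p q : R) : R :=
  if p == 0 then 0 else p `^ a * q `^ (1 - a).

Lemma renyi_term_neq0 (R : realType) (a p q : R) :
  renyi_term a p q != 0 -> p != 0.
Proof. by apply: contra_neq => ->; rewrite /renyi_term eqxx. Qed.

(** Young's inequality for the product of [u] and [1], with conjugate exponents [a] and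
    [a / (a - 1)]; the line is the tangent at [1]. *)
Lemma powR_tangent1 (R : realType) (a u : R) : 1 < a -> 0 <= u ->
  a * u + (1 - a) <= u `^ a.
Proof.
move=> a1 u0; have a0 : 0 < a by lra.
have b0 : 0 < a / (a - 1) by rewrite divr_gt0 //; lra.
have := @conjugate_powR R u 1 a (a / (a - 1)) u0 ler01 a0 b0.
rewrite powR1 mulr1 mul1r => /(_ _)/wrap[].
  by field; rewrite !gt_eqF //; lra.
rewrite -(ler_pM2l a0) => h.
have -> : u `^ a = a * (u `^ a / a + (a / (a - 1))^-1) - (a - 1).
  by field; rewrite !gt_eqF //; lra.
lra.
Qed.

(* A supporting line at ratio [r] of the function [p `^ a * q `^ (1 - a)],
   which is convex and homogeneous of degree one. *)
Lemma renyi_term_tangent (R : realType) (a r p q : R) :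
  1 < a -> 0 < r -> 0 <= p -> 0 <= q -> (q = 0 -> p = 0) ->
  a * r `^ (a - 1) * p + (1 - a) * r `^ a * q <= renyi_term a p q.
Proof.
move=> a1 r0 p0 q0 qp; rewrite /renyi_term; case: eqP => [->|/eqP pn0].
  by rewrite mulr0 add0r -mulrA mulr_le0_ge0 ?mulr_ge0 ?powR_ge0 //; lra.
have qn0 : q != 0 by apply: contra_neq pn0.
have q_gt0 : 0 < q by rewrite lt_neqAle eq_sym qn0.
(* Measuring the ratio in units of [r] reduces the tangent at [r] to the tangent at [1]. *)
pose u := p / (r * q).
have u0 : 0 <= u by rewrite divr_ge0 // mulr_ge0 // ltW.
have : p = u * (r * q) by rewrite divfK // mulf_neq0 // gt_eqF.
clearbody u => pE; subst p; have r0' := ltW r0; rewrite !powRM ?mulr_ge0 //.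
have -> : u `^ a * (r `^ a * q `^ a) * q `^ (1 - a)
        = u `^ a * (r `^ a * q).
  rewrite -!mulrA -powRD ?qn0 ?implybT //.
  have -> : a + (1 - a) = 1 by ring.
  by rewrite powRr1.
have -> : a * r `^ (a - 1) * (u * (r * q)) + (1 - a) * r `^ a * q
        = (a * u + (1 - a)) * (r `^ a * q).
  by rewrite -(mulr_powRB1 (ltW r0) (lt_trans ltr01 a1)); ring.
by rewrite ler_wpM2r ?powR_tangent1 // mulr_ge0 ?powR_ge0 // ltW.
Qed.

(** By homogeneity the supporting line touches along the whole ray [p = r * q]. *)
Lemma renyi_term_ratio (R : realType) (a r q : R) :
  1 < a -> 0 < r -> 0 <= q ->
  renyi_term a (r * q) q = a * r `^ (a - 1) * (r * q) + (1 - a) * r `^ a * q.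
Proof.
move=> a1 r0 q0; rewrite -(mulr_powRB1 (ltW r0) (lt_trans ltr01 a1)).
rewrite /renyi_term; case: eqP => [/eqP|/eqP rq0].
  by rewrite mulf_eq0 (gt_eqF r0) => /eqP ->; rewrite !mulr0 addr0.
have qn0 : q != 0 by move: rq0; rewrite mulf_eq0 (gt_eqF r0).
rewrite powRM // ?ltW // -mulrA -powRD ?qn0 ?implybT //.
have -> : a + (1 - a) = 1 by ring.
rewrite powRr1 // -(mulr_powRB1 (ltW r0) (lt_trans ltr01 a1)); ring.
Qed.

(** * Clipped pairs: existence and optimality *)

(** The last two clauses serve as complementary slackness: a value is cut below its cap only where
    the ratio is extreme. *)
Lemma clip_ratio (R : realType) (t p q : R) : 1 <= t -> 0 <= p -> 0 <= q ->
  exists r, [/\ t^-1 <= r <= t,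
    Num.min p (t * q) = r * Num.min q (t * p),
    r < t -> p <= t * q & t^-1 < r -> q <= t * p].
Proof.
move=> t1 p0 q0; have t0 : 0 < t by lra.
have tV1 : t^-1 <= 1 by rewrite invf_le1.
have le_scale x : 0 <= x -> x <= t * x by move=> x0; rewrite ler_peMl.
case: (ltP (t * q) p) => [qp|pq].
  have qp' : q <= t * p by have := le_scale _ p0; have := le_scale _ q0; lra.
  exists t; split => //; last by rewrite ltxx.
    by rewrite lexx (le_trans tV1).
  by rewrite (min_idPl qp').
case: (ltP (t * p) q) => [qp|qp].
  exists t^-1; split => //; last by rewrite ltxx.
    by rewrite lexx (le_trans tV1).
  by rewrite mulKf ?gt_eqF.
(* If [q = 0] both clipped values vanish and the ratio is free; [1] lies in the allowed range. *)
have [q_0|qn0] := eqVneq q 0.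
  have p_0 : p = 0 by move: pq; rewrite q_0; lra.
  by exists 1; split => //; rewrite ?tV1 // q_0 p_0 mulr0.
have q_gt0 : 0 < q by rewrite lt_neqAle eq_sym qn0.
exists (p / q); split => //; last by rewrite divfK // gt_eqF.
by rewrite ler_pdivlMr // ler_pdivrMr // pq andbT ler_pdivrMl.
Qed.

(** If clipping at [t = 1] leaves mass at least [1], scale down by [c]; otherwise raise [t] until
    the mass is [1], by the intermediate value theorem. The function [f] certifies that mass [1] is
    reachable. *)
Lemma exists_clipping (R : realType) (s : seq int) (p q f : int -> R) :
  (forall x, 0 <= p x) -> (forall x, 0 <= q x) ->
  (forall x, 0 <= f x <= p x) -> (forall x, q x = 0 -> f x = 0) ->
  \sum_(x <- s) f x = 1 ->
  exists c t, [/\ 0 <= c <= 1, 1 <= t, c = 1 \/ t = 1 &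
    \sum_(x <- s) c * Num.min (p x) (t * q x) = 1].
Proof.
move=> p0 q0 fp qf sf.
pose g (t : R) := \sum_(x <- s) Num.min (p x) (t * q x).
have gE c t : \sum_(x <- s) c * Num.min (p x) (t * q x) = c * g t.
  by rewrite mulr_sumr.
have [g1|g1] := lerP 1 (g 1).
  have g1_gt0 : 0 < g 1 by lra.
  exists (g 1)^-1, 1; split => //; [|by right|].
    by rewrite invr_ge0 ltW //= invf_le1.
  by rewrite gE mulVf // gt_eqF.
(* [T] exceeds every quotient [p x / q x] on [s], so clipping at [T] leaves [p] intact where
   [q x != 0]; elsewhere [f] vanishes. *)
pose T := 1 + \sum_(x <- s) p x / q x.
have T1 : 1 <= T.
  by rewrite /T lerDl sumr_ge0 // => x _; rewrite divr_ge0.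
have gT : 1 <= g T.
  rewrite -sf /g big_seq [leRHS]big_seq; apply: ler_sum => x xs.
  have /andP[f0 fpx] := fp x.
  have [qx0|qx0] := eqVneq (q x) 0.
    by rewrite (qf _ qx0) le_min p0 mulr_ge0 // (le_trans ler01).
  have qx_gt0 : 0 < q x by rewrite lt_neqAle eq_sym qx0 q0.
  rewrite le_min fpx (le_trans fpx) // -ler_pdivrMr // /T.
  rewrite (big_rem x) //= addrCA lerDl addr_ge0 // sumr_ge0 // => y _.
  by rewrite divr_ge0.
have gc : continuous g.
  move=> t; apply: cvg_big; first exact: add_continuous.
  move=> x _.
  apply: (@continuous_min R R (fun=> p x) (fun t : R => t * q x) t).
    exact: cvg_cst.
  exact: mulrr_continuous.
have [||t /andP[]] := @IVT R g 1 T 1 T1.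
- by move=> t; apply: continuous_subspaceT.
- by rewrite ge_min (ltW g1) le_max gT orbT.
rewrite bnd_simp => t1 _ gt1.
exists 1, t; split; rewrite ?ler01 ?lexx //; first by left.
by rewrite gE mul1r.
Qed.

(* The clipped pair is optimal by the KKT conditions: its ratio stays in
   [t^-1, t], and a competitor can only exceed it in numerator where the ratio
   is [t], and in denominator where the ratio is [t^-1]. *)
Lemma clipping_optimal (R : realType) (a c t : R) (s : seq int)
    (p q p1 q1 p2 q2 : int -> R) :
  let pc x := c * Num.min (p x) (t * q x) in
  let qc x := c * Num.min (q x) (t * p x) in
  1 < a -> 0 <= c -> 1 <= t -> c = 1 \/ t = 1 ->
  (forall x, 0 <= p x) -> (forall x, 0 <= q x) ->
  (forall x, [/\ 0 <= p1 x, 0 <= q1 x, 0 <= p2 x & 0 <= q2 x]) ->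
  (forall x, q1 x = 0 -> p1 x = 0) -> (forall x, q2 x = 0 -> p2 x = 0) ->
  (forall x, p1 x + p2 x <= 2 * p x) -> (forall x, q1 x + q2 x <= 2 * q x) ->
  \sum_(x <- s) pc x = 1 -> \sum_(x <- s) qc x = 1 ->
  \sum_(x <- s) p1 x = 1 -> \sum_(x <- s) q1 x = 1 ->
  \sum_(x <- s) p2 x = 1 -> \sum_(x <- s) q2 x = 1 ->
  2 * \sum_(x <- s) renyi_term a (pc x) (qc x)
    <= \sum_(x <- s) renyi_term a (p1 x) (q1 x)
       + \sum_(x <- s) renyi_term a (p2 x) (q2 x).
Proof.
move=> pc qc a1 c0 t1 ct p0 q0 pq0 qp1 qp2 p12 q12 spc sqc sp1 sq1 sp2 sq2.
have t0 : 0 < t by lra.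
pose S x := p1 x + p2 x - 2 * pc x.
pose W x := q1 x + q2 x - 2 * qc x.
have sS : \sum_(x <- s) S x = 0.
  by rewrite sumrB big_split /= -mulr_sumr sp1 sp2 spc; ring.
have sW : \sum_(x <- s) W x = 0.
  by rewrite sumrB big_split /= -mulr_sumr sq1 sq2 sqc; ring.
(* The multipliers are the slopes at the extreme ratios [t] and [t^-1]. They do not depend on [x],
   so the correction sums to zero. *)
suff H x : 2 * renyi_term a (pc x) (qc x)
    + (a * t `^ (a - 1) * S x + (1 - a) * t^-1 `^ a * W x)
    <= renyi_term a (p1 x) (q1 x) + renyi_term a (p2 x) (q2 x).
  rewrite -big_split mulr_sumr; apply: le_trans (ler_sum _ (fun x _ => H x)).
  by rewrite !big_split /= -!mulr_sumr sS sW !mulr0 !addr0.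
have [r [/andP[tr rt] rE rp rq]] := clip_ratio _ _ _ _ t1 (p0 x) (q0 x).
have r0 : 0 < r by rewrite (lt_le_trans _ tr) ?invr_gt0.
have [p1x q1x p2x q2x] := pq0 x.
have {}rE : pc x = r * qc x by rewrite /pc rE mulrCA.
have qc0 : 0 <= qc x by rewrite mulr_ge0 // le_min q0 mulr_ge0 // ltW.
have := renyi_term_tangent _ _ _ _ _ a1 r0 p1x q1x (qp1 x).
have := renyi_term_tangent _ _ _ _ _ a1 r0 p2x q2x (qp2 x).
have -> : renyi_term a (pc x) (qc x)
    = a * r `^ (a - 1) * pc x + (1 - a) * r `^ a * qc x.
  by rewrite rE renyi_term_ratio.
(* For [t = 1] the ratio sits at both extremes, so a ratio off either extreme forces [c = 1]. *)
have eq1 : t = 1 -> t^-1 = r /\ r = t.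
  by move=> t_1; move: tr rt; rewrite t_1 invr1; lra.
(* Off the ratio [t] the clip equals its cap, so [S x <= 0], and the slope at [r] is at most that at
   [t]. *)
have HS : a * t `^ (a - 1) * S x <= a * r `^ (a - 1) * S x.
  have [->//|rnt] := eqVneq r t.
  have {ct} c1 : c = 1 by case: ct => // /eq1[_ /eqP]; rewrite (negPf rnt).
  have /rp px : r < t by rewrite lt_neqAle rnt.
  have pcE : pc x = p x by rewrite /pc c1 mul1r (min_idPl px).
  apply: ler_wnM2r; first by rewrite /S pcE; have := p12 x; lra.
  by rewrite ler_wpM2l ?ge0_ler_powR ?nnegrE //; lra.
(* Likewise [W x <= 0] off the ratio [t^-1]; the negative factor [1 - a] reverses the comparison of
   powers. *)
have HW : (1 - a) * t^-1 `^ a * W x <= (1 - a) * r `^ a * W x.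
  have [->//|rnt] := eqVneq r t^-1.
  have {ct} c1 : c = 1 by case: ct => // /eq1[/esym/eqP]; rewrite (negPf rnt).
  have /rq qx : t^-1 < r by rewrite lt_neqAle eq_sym rnt.
  have qcE : qc x = q x by rewrite /qc c1 mul1r (min_idPl qx).
  apply: ler_wnM2r; first by rewrite /W qcE; have := q12 x; lra.
  apply: ler_wnM2l; first lra.
  by rewrite ge0_ler_powR ?nnegrE ?invr_ge0 //; lra.
move: HS HW; rewrite /S /W; lra.
Qed.

(** * Finitely supported sums and distributions on the integers *)

Lemma sumZE (R : realType) (s : seq int) (f : int -> R) : uniq s ->
  (forall x, f x != 0 -> x \in s) -> sumZ f = \sum_(x <- s) f x.
Proof.
move=> us fs; rewrite /sumZ (fsbigE s) //.
  by apply: eq_bigl => x; rewrite in_setT.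
by move=> x _; apply: contraNeq; exact: fs.
Qed.

Lemma sumZ_bij (R : realType) (h : int -> int) (f : int -> R) :
  bijective h -> sumZ (fun x => f (h x)) = sumZ f.
Proof. by move=> hb; rewrite /sumZ [RHS](reindex_fsbigT h). Qed.

Lemma bij_reflect (n : int) : bijective (fun x => n - x).
Proof. by exists (fun x => n - x) => x; rewrite subKr. Qed.

Lemma bij_shift : bijective (fun x : int => x - 1).
Proof. by exists (fun x => x + 1) => x; rewrite (subrK, addrK). Qed.

Lemma is_prob_bij (R : realType) (h : int -> int) (p : int -> R) :
  bijective h -> is_prob p -> is_prob (fun x => p (h x)).
Proof.
move=> hb [p0 fp sp]; split => //; last by rewrite sumZ_bij.
apply: (@finite_preimage _ _ [set x | p x != 0] h) => // x y _ _.
exact: bij_inj.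
Qed.

Lemma is_prob_cover (R : realType) (p q : int -> R) :
  is_prob p -> is_prob q -> exists2 s : seq int, uniq s &
    (forall x, p x != 0 -> x \in s) /\ (forall x, q x != 0 -> x \in s).
Proof.
move=> [_ fp _] [_ fq _].
have /finite_seqP[s sE] :
  finite_set ([set x | p x != 0] `|` [set x | q x != 0])%classic.
  by rewrite finite_setU.
exists (undup s); first exact: undup_uniq.
have ins x : p x != 0 \/ q x != 0 -> x \in undup s.
  move=> pq; rewrite mem_undup.
  by suff : [set` s]%classic x by []; rewrite -sE.
by split => x ?; apply: ins; [left|right].
Qed.

(** * Finiteness, invariance and monotonicity of Renyi sums and divergences *)

Lemma renyi_sumE (R : realType) (a : R) (p q : int -> R) :
  (forall x, q x = 0 -> p x = 0) ->
  renyi_sum a p q = (sumZ (fun x => renyi_term a (p x) (q x)))%:E.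
Proof.
move=> qp; rewrite /renyi_sum; case: asboolP => // -[x [/eqP px /qp qx]].
by case: px.
Qed.

Lemma renyi_sum_ltey (R : realType) (a : R) (p q : int -> R) :
  (renyi_sum a p q < +oo)%E -> forall x, q x = 0 -> p x = 0.
Proof.
rewrite /renyi_sum; case: asboolP => // npq _ x qx0.
by apply/eqP; apply: contraPT npq => px0; apply; exists x.
Qed.

Lemma renyi_div_ltey (R : realType) (a : R) (p q : int -> R) (v : \bar R) :
  (renyi_div a p q < v)%E -> (renyi_sum a p q < +oo)%E.
Proof.
rewrite /renyi_div ltey; case: ifP => // _.
by rewrite ltNge leey.
Qed.

Lemma renyi_sum_bij (R : realType) (a : R) (h : int -> int) (p q : int -> R) :
  bijective h ->
  renyi_sum a (fun x => p (h x)) (fun x => q (h x)) = renyi_sum a p q.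
Proof.
move=> hb; have [g hK gK] := hb; rewrite /renyi_sum.
rewrite (sumZ_bij _ h (fun x => renyi_term a (p x) (q x))) //.
congr (if _ then _ else _); apply: asbool_equiv_eq.
split => -[x pq]; first by exists (h x).
by exists (g x); rewrite gK.
Qed.

(** The supporting line at ratio [1] is [a * p + (1 - a) * q], which sums to [1]. *)
Lemma renyi_sum_ge1 (R : realType) (a : R) (p q : int -> R) :
  1 < a -> is_prob p -> is_prob q -> (1 <= renyi_sum a p q)%E.
Proof.
move=> a1 pp pq; rewrite leNgt; apply/negP => F1.
have qp := renyi_sum_ltey _ _ _ _ (lt_trans F1 (ltry 1)).
move: F1; rewrite renyi_sumE // lte_fin ltNge => /negP; apply.
have [s us [ps qs]] := is_prob_cover _ _ _ pp pq.
have [[p0 _ sp] [q0 _ sq]] := (pp, pq).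
rewrite (sumZE _ s) //; last by move=> x /renyi_term_neq0 /ps.
have -> : 1 = \sum_(x <- s) (a * 1 `^ (a - 1) * p x + (1 - a) * 1 `^ a * q x).
  by rewrite big_split /= -!mulr_sumr -!sumZE // sp sq !powR1; ring.
by apply: ler_sum => x _; apply: renyi_term_tangent => //; exact: qp.
Qed.

(** The lower bound [1] keeps the arguments where [ln] is increasing. *)
Lemma le_renyi_div (R : realType) (a : R) (p q p' q' : int -> R) :
  1 < a -> (1 <= renyi_sum a p q)%E ->
  (renyi_sum a p q <= renyi_sum a p' q')%E ->
  (renyi_div a p q <= renyi_div a p' q')%E.
Proof.
move=> a1; rewrite /renyi_div.
case: (renyi_sum a p' q') => [y||]; last 2 first.
- by move=> _ _; rewrite leey.
- by case: (renyi_sum a p q) => //= x; rewrite leeNy_eq.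
case: (renyi_sum a p q) => [x||] //=; rewrite !lee_fin => x1 xy.
by rewrite ler_pM2l ?invr_gt0 ?subr_gt0 // ler_ln // posrE; lra.
Qed.

(** * Approximate divergence as an infimum over pairs below caps *)

(** This is the second component of the mixture, so every distribution below [p / (1 - d)] occurs as
    a first component. *)
Lemma is_prob_remainder (R : realType) (d : R) (p p1 : int -> R) :
  0 < d -> is_prob p -> is_prob p1 -> (forall x, (1 - d) * p1 x <= p x) ->
  is_prob (fun x => (p x - (1 - d) * p1 x) / d).
Proof.
move=> d0 pp pp1 p1p; have [s us [ps p1s]] := is_prob_cover _ _ _ pp pp1.
have [[_ _ sp] [_ _ sp1]] := (pp, pp1).
have fs x : (p x - (1 - d) * p1 x) / d != 0 -> x \in s.
  apply: contraNT => xs.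
  have /eqP -> : p x == 0 by apply: contraNT xs => /ps.
  have /eqP -> : p1 x == 0 by apply: contraNT xs => /p1s.
  by rewrite mulr0 subr0 mul0r.
split.
- by move=> x; rewrite divr_ge0 ?subr_ge0 // ltW.
- exact: (@sub_finite_set _ _ [set` s]%classic).
rewrite (sumZE _ s) // -mulr_suml sumrB -mulr_sumr -!sumZE // sp sp1.
by field; rewrite gt_eqF.
Qed.

Lemma approx_renyi_div_le (R : realType) (a d : R) (p q p1 q1 : int -> R) :
  0 < d -> is_prob p -> is_prob q -> is_prob p1 -> is_prob q1 ->
  (forall x, (1 - d) * p1 x <= p x) -> (forall x, (1 - d) * q1 x <= q x) ->
  (approx_renyi_div a d p q <= renyi_div a p1 q1)%E.
Proof.
move=> d0 pp pq pp1 pq1 p1p q1q; apply: ereal_inf_lbound.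
exists p1, (fun x => (p x - (1 - d) * p1 x) / d), q1,
  (fun x => (q x - (1 - d) * q1 x) / d); split=> //.
- exact: is_prob_remainder.
- exact: is_prob_remainder.
by split => // x; field; rewrite gt_eqF.
Qed.

(** A strict bound is met by an actual decomposition, even if the infimum is not attained. *)
Lemma approx_renyi_div_lt (R : realType) (a d : R) (p q : int -> R)
    (v : \bar R) : 0 < d -> (approx_renyi_div a d p q < v)%E ->
  exists p1 q1, [/\ is_prob p1, is_prob q1,
    (forall x, (1 - d) * p1 x <= p x), (forall x, (1 - d) * q1 x <= q x) &
    (renyi_div a p1 q1 < v)%E].
Proof.
move=> d0 /ereal_inf_lt[_ [p1 [p2 [q1 [q2 [pp1 pp2 pq1 pq2 [pE qE ->]]]]]]] lt_v.
have [[p20 _ _] [q20 _ _]] := (pp2, pq2).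
exists p1, q1; split => // x; rewrite (pE, qE) lerDl mulr_ge0 //; exact: ltW.
Qed.

(* Averaging [X] with its reflection makes the caps of the two decompositions
   reflections of each other, and hence also the two clipped distributions. *)
Lemma exists_symmetric_feasible (R : realType) (a d : R) (n : nat)
    (X p1 q1 p2 q2 : int -> R) :
  1 < a -> 0 < d < 1 -> is_prob X -> supported_on X 0 (n%:Z - 1) ->
  is_prob p1 -> is_prob q1 -> is_prob p2 -> is_prob q2 ->
  (forall x, (1 - d) * p1 x <= X x) -> (forall x, (1 - d) * q1 x <= X (x - 1)) ->
  (forall x, (1 - d) * p2 x <= X (n%:Z - 1 - x)) ->
  (forall x, (1 - d) * q2 x <= X (n%:Z - x)) ->
  (renyi_sum a p1 q1 < +oo)%E -> (renyi_sum a p2 q2 < +oo)%E ->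
  exists Q Q', cp_feasible d n Q Q' /\
    (cp_obj a n Q' <= maxe (renyi_sum a p1 q1) (renyi_sum a p2 q2))%E.
Proof.
move=> a1 /andP[d0 d1] pX sX pp1 pq1 pp2 pq2 p1X q1X p2X q2X fin1 fin2.
have qp1 := renyi_sum_ltey _ _ _ _ fin1.
have qp2 := renyi_sum_ltey _ _ _ _ fin2.
rewrite (renyi_sumE _ _ _ _ qp1) (renyi_sumE _ _ _ _ qp2) {fin1 fin2}.
have m0 : 0 < 1 - d by lra.
have [[X0 _ X1] [p10 _ p11] [q10 _ q11]] := And3 pX pp1 pq1.
have [[p20 _ p21] [q20 _ q21]] := (pp2, pq2).
have eq0_le (y z : R) : 0 <= y -> (1 - d) * y <= z -> z = 0 -> y = 0.
  by move=> y0 yz z0; apply/le_anti; rewrite y0 andbT -(ler_pM2l m0) mulr0 -z0.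
pose Q x := (X x + X (n%:Z - 1 - x)) / 2.
pose U x := Q x / (1 - d).
pose V x := U (x - 1).
have Qr x : Q (n%:Z - 1 - x) = Q x.
  by rewrite /Q addrC; congr ((X _ + X _) / _); ring.
have Ur x : U (n%:Z - x) = V x by rewrite /V /U -[in RHS]Qr; congr (Q _ / _); ring.
have Vr x : V (n%:Z - x) = U x by rewrite /V /U -[in RHS]Qr; congr (Q _ / _); ring.
have Q0 x : 0 <= Q x by rewrite divr_ge0 // addr_ge0.
have U0 x : 0 <= U x by rewrite divr_ge0 // ltW.
have V0 x : 0 <= V x by exact: U0.
have UE x : (1 - d) * U x = (X x + X (n%:Z - 1 - x)) / 2.
  by rewrite mulrC divfK // gt_eqF.
have VE x : (1 - d) * V x = (X (x - 1) + X (n%:Z - x)) / 2.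
  by rewrite UE; congr ((_ + X _) / _); ring.
have sQ : supported_on Q 0 (n%:Z - 1).
  move=> x; have [Xx|/sX //] := eqVneq (X x) 0.
  have [Xrx|/sX] := eqVneq (X (n%:Z - 1 - x)) 0; last by lia.
  by rewrite /Q Xx Xrx addr0 mul0r eqxx.
(* The list runs up to [n] inclusive because the shift of [X] lives on [1] to [n]. *)
pose s : seq int := [seq Posz i | i <- iota 0 n.+1].
have us : uniq s by rewrite map_inj_uniq ?iota_uniq // => i j [].
have ins x : 0 <= x <= n%:Z -> x \in s.
  case: x => // i /andP[_ iln]; apply: map_f.
  by rewrite mem_iota add0n ltnS -lez_nat.
have UV x : U x != 0 -> 0 <= x <= n%:Z - 1.
  by move=> Ux; apply: sQ; apply: contra_neq Ux => Qx; rewrite /U Qx mul0r.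
have p1s x : p1 x != 0 -> x \in s.
  move=> h; have /sX : X x != 0.
    by apply: contra_neq h; exact: eq0_le.
  by move=> ?; apply: ins; lia.
have q1s x : q1 x != 0 -> x \in s.
  move=> h; have /sX : X (x - 1) != 0.
    by apply: contra_neq h; exact: eq0_le.
  by move=> ?; apply: ins; lia.
have p2s x : p2 x != 0 -> x \in s.
  move=> h; have /sX : X (n%:Z - 1 - x) != 0.
    by apply: contra_neq h; exact: eq0_le.
  by move=> ?; apply: ins; lia.
have q2s x : q2 x != 0 -> x \in s.
  move=> h; have /sX : X (n%:Z - x) != 0.
    by apply: contra_neq h; exact: eq0_le.
  by move=> ?; apply: ins; lia.
have p12 x : p1 x + p2 x <= 2 * U x.
  by rewrite -(ler_pM2l m0) mulrCA UE; have := p1X x; have := p2X x; lra.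
have q12 x : q1 x + q2 x <= 2 * V x.
  by rewrite -(ler_pM2l m0) mulrCA VE; have := q1X x; have := q2X x; lra.
(* The average of [p1] and [p2] certifies reachability: it lies below [U], and where [V] vanishes so
   do [q1] and [q2], hence [p1] and [p2]. *)
have [|||c [t [/andP[c0 c1] t1 ct spc]]] :=
  exists_clipping _ s U V (fun x => (p1 x + p2 x) / 2) U0 V0.
- by move=> x; have := p12 x; have := p10 x; have := p20 x; lra.
- move=> x Vx; have := q12 x; have := q10 x; have := q20 x.
  by rewrite Vx => ? ? ?; rewrite qp1 ?qp2 ?addr0 ?mul0r //; lra.
- by rewrite -mulr_suml big_split /= -!sumZE // p11 p21; lra.
have t0 : 0 < t by lra.
pose pc x := c * Num.min (U x) (t * V x).
pose qc x := c * Num.min (V x) (t * U x).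
have pcr x : pc (n%:Z - x) = qc x by rewrite /pc Ur Vr.
have pc0 x : 0 <= pc x.
  by rewrite mulr_ge0 // le_min U0 mulr_ge0 // ltW.
have qcpc x : qc x = 0 -> pc x = 0.
  have [r [_ rE _ _]] := clip_ratio _ _ _ _ t1 (U0 x) (V0 x).
  by rewrite /pc /qc rE [c * (r * _)]mulrCA => ->; rewrite mulr0.
have pcU x : pc x <= U x.
  apply: (@le_trans _ _ (c * U x)).
    by rewrite ler_wpM2l // ge_min lexx.
  by rewrite ler_piMl.
have pcV x : V x = 0 -> pc x = 0.
  by move=> Vx; rewrite /pc Vx mulr0 (min_idPr (U0 x)) mulr0.
(* The clip vanishes where either cap does; [U] lives on [0] to [n - 1] and [V] on [1] to [n]. *)
have sP : supported_on pc 1 (n%:Z - 1).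
  move=> x px; have Ux : U x != 0.
    by apply: contra_neq px => Ux; have := pcU x; have := pc0 x; lra.
  have Vx : V x != 0 by apply: contra_neq px; exact: pcV.
  by have := UV _ Ux; have := UV _ Vx; lia.
have pcs x : pc x != 0 -> x \in s by move=> /sP ?; apply: ins; lia.
have ppc : is_prob pc.
  split=> //; last by rewrite (sumZE _ s).
  exact: (@sub_finite_set _ _ [set` s]%classic).
exists Q, pc; split.
  split; last by move=> x; rewrite Qr.
  split=> //; last by move=> x; rewrite pc0 pcU.
  split=> //; first apply: (@sub_finite_set _ _ [set` s]%classic) => //.
    by move=> x /sQ ?; apply: ins; lia.
  have Qs x : Q x != 0 -> x \in s by move=> /sQ ?; apply: ins; lia.
  have Xs x : X x != 0 -> x \in s by move=> /sX ?; apply: ins; lia.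
  have Xrs x : X (n%:Z - 1 - x) != 0 -> x \in s.
    by move=> /sX ?; apply: ins; lia.
  rewrite (sumZE _ s) // -mulr_suml big_split /= -!sumZE //.
  by rewrite (sumZ_bij _ _ X (bij_reflect _)) X1; lra.
have term_s (f g : int -> R) : (forall x, f x != 0 -> x \in s) ->
  sumZ (fun x => renyi_term a (f x) (g x))
  = \sum_(x <- s) renyi_term a (f x) (g x).
  by move=> fs; apply: sumZE => // x /renyi_term_neq0 /fs.
rewrite /cp_obj renyi_sumE; last by move=> x; rewrite pcr; exact: qcpc.
rewrite !term_s //.
under eq_bigr do rewrite pcr.
rewrite -EFin_max lee_fin.
have sqc : \sum_(x <- s) qc x = 1.
  have [_ _ <-] := ppc.
  rewrite -(sumZ_bij _ _ pc (bij_reflect n%:Z)) (sumZE _ s) //.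
    by apply: eq_bigr => x _; rewrite pcr.
  by move=> x /sP ?; apply: ins; lia.
have pq0 x : [/\ 0 <= p1 x, 0 <= q1 x, 0 <= p2 x & 0 <= q2 x] by split.
have sumsE (f : int -> R) : (forall x, f x != 0 -> x \in s) -> sumZ f = 1 ->
  \sum_(x <- s) f x = 1 by move=> fs <-; rewrite (sumZE _ s).
have H := clipping_optimal R a c t s U V p1 q1 p2 q2 a1 c0 t1 ct U0 V0 pq0
  qp1 qp2 p12 q12 spc sqc (sumsE _ p1s p11) (sumsE _ q1s q11)
  (sumsE _ p2s p21) (sumsE _ q2s q21).
(* A value exceeding both sums would, doubled, exceed their total, against [H]. *)
rewrite le_max leNgt [X in _ || X]leNgt -negb_and; apply/negP => /andP[lt1 lt2].
by move: H; rewrite leNgt => /negP; apply; rewrite mulr_natl mulr2n ltrD.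
Qed.

(** * Comparison of the convex optimum with an arbitrary noise distribution *)

Theorem mainTheorem13 (R : realType) (a d : R) (nd : nat) (P P' : int -> R) :
  1 < a -> 0 < d < 1 ->
  cp_feasible d nd P P' ->
  (forall Q Q' : int -> R, cp_feasible d nd Q Q' ->
     (cp_obj a nd P' <= cp_obj a nd Q')%E) ->
  forall X : int -> R, is_prob X -> supported_on X 0 (nd%:Z - 1) ->
    (rdp_eps a d P <= rdp_eps a d X)%E.
Proof.
move=> a1 d01 [[pP sP pP' sP' P'P] Psym] Popt X pX sX.
have /andP[d0 d1] := d01; have m0 : 0 < 1 - d by lra.
have refl_bij := bij_reflect nd%:Z.
pose P'r x := P' (nd%:Z - x).
have pP'r : is_prob P'r by exact: is_prob_bij.
have shift_prob p : is_prob p -> is_prob (shiftZ p).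
  by apply: is_prob_bij; exact: bij_shift.
have capP x : (1 - d) * P' x <= P x.
  by have /andP[_] := P'P x; rewrite ler_pdivlMr // mulrC.
have capPr x : (1 - d) * P'r x <= shiftZ P x.
  apply: le_trans (capP _) _; rewrite Psym /shiftZ.
  by rewrite le_eqVlt; apply/orP; left; apply/eqP; congr (P _); ring.
have F1 := renyi_sum_ge1 _ _ _ _ a1 pP' pP'r.
(* Reflection swaps the two members of the pair, so one value bounds the divergence in both
   directions. *)
have eqF : renyi_sum a P'r P' = renyi_sum a P' P'r.
  rewrite -(renyi_sum_bij _ _ _ P' P'r refl_bij).
  by congr (renyi_sum a _ _); apply/funext => x; rewrite /P'r subKr.
apply: (@le_trans _ _ (renyi_div a P' P'r)).
  rewrite /rdp_eps ge_max approx_renyi_div_le //=; last exact: shift_prob.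
  have -> : renyi_div a P' P'r = renyi_div a P'r P' by rewrite /renyi_div eqF.
  by apply: approx_renyi_div_le => //; exact: shift_prob.
(* If [X] did strictly better, actual decompositions in both directions would undercut the value of
   the optimum. *)
rewrite leNgt; apply/negP; rewrite /rdp_eps gt_max => /andP[].
move=> /(approx_renyi_div_lt _ _ _ _ _ _ d0)[p1 [q1 [pp1 pq1 p1X q1X v1]]].
move=> /(approx_renyi_div_lt _ _ _ _ _ _ d0)[p2 [q2 [pp2 pq2 p2X q2X v2]]].
(* Reflecting by [nd - x] sends the caps [X (x - 1)] and [X x] of the second pair to
   [X (nd - 1 - x)] and [X (nd - x)]. *)
have [||||||||Q [Q' [feas]]] := exists_symmetric_feasible _ _ _ nd X p1 q1
  (fun x => p2 (nd%:Z - x)) (fun x => q2 (nd%:Z - x)) a1 d01 pX sX pp1 pq1.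
- exact: is_prob_bij.
- exact: is_prob_bij.
- by [].
- by [].
- by move=> x; have := p2X (nd%:Z - x); rewrite /shiftZ addrAC.
- by move=> x; exact: q2X.
- exact: renyi_div_ltey v1.
- by rewrite renyi_sum_bij //; exact: renyi_div_ltey v2.
rewrite renyi_sum_bij // le_max => /orP[] /(le_trans (Popt _ _ feas)).
- by move=> /(le_renyi_div _ _ _ _ _ _ a1 F1); rewrite leNgt v1.
- by move=> /(le_renyi_div _ _ _ _ _ _ a1 F1); rewrite leNgt v2.
Qed.
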